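(* Let $p=2$, let $h$ satisfy $\lim_{t\to\infty}\frac{h'(t)}{t\,h(t)}=0$, and let $\{(\lambda_n,\mu_n,u_n)\}$ be a sequence of solutions (in the sense of the context) with $\mu_n\to\infty$ as $n\to\infty$. Then, up to a subsequence, there exists a sequence $(r_n)\subset(0,1)$ such that $u_n(r_n)/\mu_n\to0$ as $n\to\infty$ and \[ \lim_{n\to\infty}2\mu_n\int_0^{r_n}\lambda_nf(u_n)\,r\,dr=4. \] Moreover, \[ \lim_{n\to\infty}\frac{\log\frac1{\lambda_n}}{\mu_n^2}=0. \]
   Context: $h:[0,\infty)\to\mathbb{R}$ is a nonnegative $C^1$ function and there is $t_0>0$ with $h(t)>0$ for all $t\ge t_0$; here $f(t)=h(t)e^{t^2}$. A sequence of solutions $\{(\lambda_n,\mu_n,u_n)\}$ means: for every $n\in\mathbb N$, $\lambda_n>0$, $\mu_n>0$, and $u_n$ is a classical solution on $[0,1]$ of $-u_n''-\frac1r u_n'=\lambda_nf(u_n)$, $u_n>0$ in $(0,1)$, $u_n(0)=\mu_n$, $u_n'(0)=0=u_n(1)$. ''Up to a subsequence'' means after passing to a subsequence in $n$, not relabelled. *)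

(* Defs.v *)
From Stdlib Require Import Reals.
From Coquelicot Require Import Coquelicot.
Open Scope R_scope.

(* [g] is C^1 on [D] with derivative [g']. [D_in] and [continue_in] are limits
   within [D], hence one-sided at an endpoint of an interval; values of [g] and
   [g'] outside [D] are irrelevant. *)
Definition C1_on (D : R -> Prop) (g g' : R -> R) : Prop :=
  forall x, D x -> D_in g g' D x /\ continue_in g' D x.

Definition nonlin (h : R -> R) (t : R) : R := h t * exp (t ^ 2).

(* The equation is singular at r = 0, so it is required on (0,1), for
   u in C^1([0,1]) and C^2((0,1)); together with u'(0) = 0 this yields
   u in C^2([0,1]) and the equation at r = 1 when f is continuous
   on [0,+oo). *)
Definition solution (f : R -> R) (lambda mu : R) (u : R -> R) : Prop :=
  0 < lambda /\ 0 < mu /\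
  exists u' u'' : R -> R,
    C1_on (fun r => 0 <= r <= 1) u u' /\
    C1_on (fun r => 0 < r < 1) u' u'' /\
    (forall r, 0 < r < 1 -> - u'' r - 1 / r * u' r = lambda * f (u r)) /\
    (forall r, 0 < r < 1 -> 0 < u r) /\
    u 0 = mu /\ u' 0 = 0 /\ u 1 = 0.

(* Main.v *)
(* Put D = r d/dr, M = - mu D u and Q = mu lambda r^2 f(u).  Then D M = Q and
   D Q = Q (2 - M f'(u) / (mu f(u))), where f'/f is asymptotic to 2t by the
   hypothesis on h.  While u is close to mu this is almost the logistic system
   D M = Q = M (2 - M): precisely, Q - 2 M + a M^2 / 2 is monotone for a slightly
   above, resp. below, 2.  Hence M climbs to almost 2 while u loses only O(1/mu).
   From then on u drops at speed about 2/mu in log r, and Q behaves like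
   exp(u^2 - mu u), which is exponentially small for eps mu <= u <= 3 mu / 4; so M
   stays close to 2 until u = eps mu.  Since the whole descent of u from mu to 0
   takes about mu^2/2 in log r, and Q is of order 1 at its start r1, taking the
   logarithm of Q(r1) gives log lambda = 2 log(1/r1) - mu^2 + o(mu^2) = o(mu^2). *)

Require Import Defs.
From Stdlib Require Import Reals Lra IndefiniteDescription.
From Coquelicot Require Import Coquelicot.
Open Scope R_scope.

(** * Monotonicity from the derivative, and passage from one-sided to two-sided limits *)

Lemma derivative_nonneg_le (g dg : R -> R) (a b : R) :
  a <= b ->
  (forall x, a < x < b -> is_derive g x (dg x)) ->
  (forall x, a <= x <= b -> continuity_pt g x) ->
  (forall x, a < x < b -> 0 <= dg x) ->
  g a <= g b.
Proof.
  intros Hab Hd Hc Hpos.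
  (* The mean value point may be an endpoint, where [dg] has no known sign. Truncation at 0 changes
     nothing on the open interval and is nonnegative everywhere. *)
  destruct (MVT_gen g a b (fun x => Rmax 0 (dg x))) as [c [_ Hmvt]].
  - intros x Hx. rewrite Rmin_left, Rmax_right in Hx by lra.
    rewrite Rmax_right by (apply Hpos; exact Hx). apply Hd; exact Hx.
  - intros x Hx. rewrite Rmin_left, Rmax_right in Hx by lra. apply Hc; exact Hx.
  - assert (0 <= Rmax 0 (dg c) * (b - a)) by (apply Rmult_le_pos; [apply Rmax_l|lra]).
    lra.
Qed.

Lemma is_derive_continuity_pt (g : R -> R) (x l : R) :
  is_derive g x l -> continuity_pt g x.
Proof.
  intros H. apply derivable_continuous_pt. exists l. apply is_derive_Reals; exact H.
Qed.

(** Composing with a 1-Lipschitz map into [D] extends a function continuous within [D] to the whole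
    line; [p] will be the projection onto [0,1] or onto the half-line. *)
Lemma continue_in_retract (D : R -> Prop) (p g : R -> R) :
  (forall x, D (p x)) ->
  (forall x y, Rabs (p x - p y) <= Rabs (x - y)) ->
  (forall x, D x -> continue_in g D x) ->
  continuity (fun x => g (p x)).
Proof.
  intros HD Hp Hg x e He.
  destruct (Hg (p x) (HD x) e He) as [d [Hd Hlim]].
  exists d; split; [exact Hd|].
  intros y [_ Hy]. simpl in *. unfold Rdist in *.
  (* The limit within [D] leaves out the base point itself, and [p] may send [y] to it. *)
  destruct (Req_dec (p y) (p x)) as [->|Hne].
  - rewrite Rminus_diag, Rabs_R0; exact He.
  - apply (Hlim (p y)). split.
    + split; [apply HD|congruence].
    + eapply Rle_lt_trans; [apply Hp|exact Hy].
Qed.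

Lemma D_in_is_derive (D : R -> Prop) (g g' : R -> R) (x : R) :
  locally x D -> D_in g g' D x -> is_derive g x (g' x).
Proof.
  intros [d HdD] Hg. apply is_derive_Reals. intros e He.
  destruct (Hg e He) as [a [Ha Hlim]].
  assert (0 < Rmin a d) as Hm by (apply Rmin_pos; [exact Ha|apply cond_pos]).
  exists (mkposreal _ Hm). intros k Hk0 Hk. simpl in Hk.
  assert (Rabs k < a) by (eapply Rlt_le_trans; [exact Hk|apply Rmin_l]).
  assert (Rabs k < d) by (eapply Rlt_le_trans; [exact Hk|apply Rmin_r]).
  specialize (Hlim (x + k)). simpl in Hlim. unfold Rdist in Hlim.
  replace (x + k - x) with k in Hlim by ring.
  apply Hlim. split; [split|assumption].
  - apply HdD. unfold ball; simpl. unfold AbsRing_ball, abs, minus, plus, opp; simpl.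
    replace (x + k + - x) with k by ring. assumption.
  - lra.
Qed.

(** * From classical solutions on [0,1] to profiles continuous on the line *)

Definition clip (x : R) : R := Rmax 0 (Rmin x 1).

Lemma clip_bounds (x : R) : 0 <= clip x <= 1.
Proof. unfold clip, Rmax, Rmin; repeat destruct Rle_dec; lra. Qed.

Lemma clip_id (x : R) : 0 <= x <= 1 -> clip x = x.
Proof. intros; unfold clip, Rmax, Rmin; repeat destruct Rle_dec; lra. Qed.

Lemma clip_lipschitz (x y : R) : Rabs (clip x - clip y) <= Rabs (x - y).
Proof.
  unfold clip, Rmax, Rmin; repeat destruct Rle_dec;
    apply Rabs_le; unfold Rabs; destruct Rcase_abs; lra.
Qed.

Lemma Rmax0_lipschitz (x y : R) : Rabs (Rmax 0 x - Rmax 0 y) <= Rabs (x - y).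
Proof.
  unfold Rmax; repeat destruct Rle_dec;
    apply Rabs_le; unfold Rabs; destruct Rcase_abs; lra.
Qed.

Lemma locally_open_interval (a b x : R) :
  a < x < b -> locally x (fun y => a < y < b).
Proof.
  intros Hx.
  apply (locally_interval _ x a b); simpl; try lra.
  intros; split; assumption.
Qed.

(* [M] stands for [- mu r v'(r)]; outside [0,1] only the continuity of [v] and
   [M] matters. *)
Definition profile (f : R -> R) (lam mu : R) (v M : R -> R) : Prop :=
  (0 < lam /\ 0 < mu) /\ (continuity v /\ continuity M) /\
  (forall r, 0 < r < 1 -> is_derive v r (- (M r / (mu * r)))) /\
  (forall r, 0 < r < 1 -> is_derive M r (mu * lam * r * f (v r))) /\
  (v 0 = mu /\ v 1 = 0 /\ M 0 = 0) /\
  (forall r, 0 < r < 1 -> 0 < v r).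

(* [fe] is a continuous extension of [f], which is only controlled on [0,+oo). *)
Lemma solution_profile (f fe : R -> R) (lam mu : R) (u : R -> R) :
  (forall t, 0 <= t -> fe t = f t) -> continuity fe ->
  solution f lam mu u ->
  exists v M : R -> R, profile fe lam mu v M /\
    (forall r, 0 <= r <= 1 -> v r = u r) /\
    (forall r, 0 < r < 1 ->
       RInt (fun s => lam * f (u s) * s) 0 r = M r / mu).
Proof.
  intros Hfe Cfe (Hlam & Hmu & u' & u'' & C1u & C1u' & Heq & Hpos & Hu0 & Hu'0 & Hu1).
  (* On [0,1], [m] is - r u'(r), so that the radial equation becomes m' = [lam] r f(u) and [M] is
     [mu] times [m]. *)
  set (v := fun r => u (clip r)). set (m := fun r => - (clip r * u' (clip r))).
  assert (Cv : continuity v).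
  { apply (continue_in_retract (fun r => 0 <= r <= 1) clip).
    - apply clip_bounds.
    - apply clip_lipschitz.
    - intros x Hx. apply (cont_deriv u u' _ x). apply C1u; exact Hx. }
  assert (Cu' : continuity (fun r => u' (clip r))).
  { apply (continue_in_retract (fun r => 0 <= r <= 1) clip).
    - apply clip_bounds.
    - apply clip_lipschitz.
    - intros x Hx. apply C1u; exact Hx. }
  assert (Cclip : continuity clip).
  { intros x e He. exists e; split; [exact He|]. intros y [_ Hy]. simpl in *.
    unfold Rdist in *. eapply Rle_lt_trans; [apply clip_lipschitz|exact Hy]. }
  assert (Cm : continuity m).
  { apply continuity_opp. apply (continuity_mult clip (fun r => u' (clip r))); assumption. }
  assert (Vu : forall r, 0 <= r <= 1 -> v r = u r).
  { intros r Hr. unfold v. rewrite clip_id by exact Hr. reflexivity. }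
  assert (Dv : forall r, 0 < r < 1 -> is_derive v r (u' r)).
  { intros r Hr. apply (is_derive_ext_loc u).
    - generalize (locally_open_interval 0 1 r Hr). apply filter_imp.
      intros y Hy. rewrite Vu by lra. reflexivity.
    - apply (D_in_is_derive (fun r => 0 <= r <= 1)); [|apply C1u; lra].
      generalize (locally_open_interval 0 1 r Hr). apply filter_imp. intros; lra. }
  assert (Dm : forall r, 0 < r < 1 -> is_derive m r (lam * fe (v r) * r)).
  { intros r Hr. apply (is_derive_ext_loc (fun r => - (r * u' r))).
    - generalize (locally_open_interval 0 1 r Hr). apply filter_imp.
      intros y Hy. unfold m. rewrite clip_id by lra. reflexivity.
    - assert (is_derive u' r (u'' r)) as Hu''.
      { apply (D_in_is_derive (fun r => 0 < r < 1)); [|apply C1u'; lra].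
        apply locally_open_interval; exact Hr. }
      rewrite Vu by lra. rewrite Hfe by (left; apply Hpos; exact Hr).
      replace (lam * f (u r) * r) with (- (1 * u' r + r * u'' r)).
      2:{ rewrite <- (Heq r Hr). field. lra. }
      apply (is_derive_opp (fun r => r * u' r)).
      apply (is_derive_mult (fun r => r) u' r 1 (u'' r)).
      + apply (is_derive_id r).
      + exact Hu''.
      + intros; apply Rmult_comm. }
  exists v, (fun r => mu * m r). split; [|split].
  - split; [split; assumption|]. split; [split; [exact Cv|]|].
    { apply continuity_scal; exact Cm. }
    split; [|split; [|split; [|]]].
    + intros r Hr. replace (- (mu * m r / (mu * r))) with (u' r).
      * apply Dv; exact Hr.
      * unfold m. rewrite clip_id by lra. field. lra.
    + intros r Hr. replace (mu * lam * r * fe (v r)) with (mu * (lam * fe (v r) * r)) by ring.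
      apply (is_derive_scal m). apply Dm; exact Hr.
    + rewrite !Vu by lra. unfold m. rewrite clip_id by lra. rewrite Hu0, Hu1. repeat split; ring.
    + intros r Hr. rewrite Vu by lra. apply Hpos; exact Hr.
  - exact Vu.
  - intros r Hr. replace (mu * m r / mu) with (minus (m r) (m 0)).
    2:{ unfold minus, plus, opp, m; simpl. rewrite (clip_id 0) by lra. field. lra. }
    apply is_RInt_unique.
    apply is_RInt_ext with (fun s => lam * fe (v s) * s).
    { intros s Hs. rewrite Rmin_left, Rmax_right in Hs by lra.
      rewrite Vu by lra. rewrite Hfe by (left; apply Hpos; lra). reflexivity. }
    apply (is_RInt_derive (V := R_CompleteNormedModule) m (fun s => lam * fe (v s) * s) 0 r).
    + intros s Hs. rewrite Rmin_left, Rmax_right in Hs by lra.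
      (* The fundamental theorem also asks for the derivative of [m] at 0, where the equation says
         nothing. The difference quotient there is - ([clip k] / k) u'([clip k]), bounded by
         |u'([clip k])|, which tends to u'(0) = 0. *)
      destruct (Req_dec s 0) as [->|Hs0]; [|apply Dm; lra].
      replace (lam * fe (v 0) * 0) with 0 by ring.
      apply is_derive_Reals. intros e He.
      destruct (Cu' 0 e He) as [d [Hd Hlim]].
      exists (mkposreal d Hd). intros k Hk0 Hk. simpl in Hk.
      specialize (Hlim k). simpl in Hlim. unfold Rdist in Hlim.
      rewrite (clip_id 0), Hu'0 in Hlim by lra.
      assert (Rabs (u' (clip k) - 0) < e) as Hk'.
      { apply Hlim. split; [split; [exact I|lra]|]. rewrite Rminus_0_r; exact Hk. }
      unfold m. rewrite (clip_id 0), Rplus_0_l by lra.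
      eapply Rle_lt_trans; [|exact Hk'].
      replace ((- (clip k * u' (clip k)) - - (0 * u' 0)) / k - 0)
        with (- (clip k / k * (u' (clip k) - 0))) by (field; exact Hk0).
      rewrite Rabs_Ropp, Rabs_mult.
      rewrite <- (Rmult_1_l (Rabs (u' (clip k) - 0))) at 2.
      apply Rmult_le_compat_r; [apply Rabs_pos|].
      rewrite Rabs_div by exact Hk0.
      apply Rmult_le_reg_r with (Rabs k); [apply Rabs_pos_lt; exact Hk0|].
      replace (Rabs (clip k) / Rabs k * Rabs k) with (Rabs (clip k))
        by (field; apply Rabs_no_R0; exact Hk0).
      generalize (clip_lipschitz k 0). rewrite (clip_id 0) by lra. rewrite !Rminus_0_r. lra.
    + intros s _. apply continuity_pt_filterlim.
      apply (continuity_mult (fun s => lam * fe (v s)) (fun s => s)).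
      * apply (continuity_scal (fun s => fe (v s)) lam). apply (continuity_comp v fe); assumption.
      * apply derivable_continuous, derivable_id.
Qed.
(** [auto_derive] leaves unevaluated terms [Derive] in its result; this replaces one by the value
    known from [H]. *)
Ltac rewrite_Derive H :=
  let K := fresh in
  pose proof H as K;
  match type of K with
  | is_derive ?g ?x ?l =>
      replace (Derive (fun y : R => g y) x) with l
        by (symmetry; apply is_derive_unique; exact K)
  end; clear K.

(** * Logarithmic growth of the nonlinearity *)

(** The asymptotics f'/f ~ 2t with relative error d/2 beyond [T], multiplied out. Together with
    continuity and nonnegativity, this is all that the estimates of a single profile use about f. *)
Definition near_gaussian (f df : R -> R) (d T : R) : Prop :=
  forall t, T <= t ->
    is_derive f t (df t) /\ 0 < f t /\
    (2 - d) * t * f t <= df t <= (2 + d) * t * f t.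

(** Integrates the bounds on f'/f: ln f(t) - c t^2 is nondecreasing for c = 1 - d/2 and
    nonincreasing for c = 1 + d/2. *)
Lemma near_gaussian_ln (f df : R -> R) (d T s t : R) :
  near_gaussian f df d T -> T <= s <= t ->
  (1 - d / 2) * (t ^ 2 - s ^ 2) <= ln (f t) - ln (f s) <= (1 + d / 2) * (t ^ 2 - s ^ 2).
Proof.
  intros Hf Hst.
  assert (Hln : forall x c, T <= x ->
    is_derive (fun y => ln (f y) - c * y ^ 2) x (df x / f x - 2 * c * x)).
  { intros x c Hx. destruct (Hf x Hx) as (Hd & Hp & _).
    auto_derive; [repeat split; [exists (df x); exact Hd|exact Hp]|].
    rewrite_Derive Hd. field. lra. }
  assert (Hdiv : forall x, T <= x -> (2 - d) * x <= df x / f x <= (2 + d) * x).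
  { intros x Hx. destruct (Hf x Hx) as (_ & Hp & Hb).
    split; apply Rmult_le_reg_r with (f x); try exact Hp;
      replace (df x / f x * f x) with (df x) by (field; lra); lra. }
  split.
  - assert (ln (f s) - (1 - d / 2) * s ^ 2 <= ln (f t) - (1 - d / 2) * t ^ 2); [|lra].
    apply (derivative_nonneg_le (fun x => ln (f x) - (1 - d / 2) * x ^ 2)
      (fun x => df x / f x - 2 * (1 - d / 2) * x)); [lra| | |].
    + intros x Hx. apply (Hln x (1 - d / 2)); lra.
    + intros x Hx. eapply is_derive_continuity_pt. apply (Hln x (1 - d / 2)); lra.
    + intros x Hx. generalize (Hdiv x ltac:(lra)). unfold Rdiv. lra.
  - assert (- (ln (f s) - (1 + d / 2) * s ^ 2) <= - (ln (f t) - (1 + d / 2) * t ^ 2)); [|lra].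
    apply (derivative_nonneg_le (fun x => - (ln (f x) - (1 + d / 2) * x ^ 2))
      (fun x => - (df x / f x - 2 * (1 + d / 2) * x))); [lra| | |].
    + intros x Hx. apply (is_derive_opp (fun x => ln (f x) - (1 + d / 2) * x ^ 2)).
      apply (Hln x (1 + d / 2)); lra.
    + intros x Hx. eapply is_derive_continuity_pt.
      apply (is_derive_opp (fun x => ln (f x) - (1 + d / 2) * x ^ 2)).
      apply (Hln x (1 + d / 2)); lra.
    + intros x Hx. generalize (Hdiv x ltac:(lra)). unfold Rdiv. lra.
Qed.

(** * Monotonicity of profiles and their speed in log r *)

(** This is Q = D M with D = r d/dr. *)
Definition source (f : R -> R) (lam mu : R) (v : R -> R) (r : R) : R :=
  mu * lam * r ^ 2 * f (v r).

Lemma profile_M_le (f : R -> R) (lam mu : R) (v M : R -> R) (r s : R) :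
  (forall t, 0 <= t -> 0 <= f t) -> profile f lam mu v M ->
  0 <= r <= s -> s <= 1 -> M r <= M s.
Proof.
  intros Hf ((Hlam & Hmu) & (Cv & CM) & Dv & DM & _ & Hpos) Hrs Hs.
  apply (derivative_nonneg_le M (fun r => mu * lam * r * f (v r))); [lra| | |].
  - intros x Hx. apply DM; lra.
  - intros x _. apply CM.
  - intros x Hx. apply Rmult_le_pos; [|apply Hf; left; apply Hpos; lra].
    apply Rmult_le_pos; [apply Rmult_le_pos|]; lra.
Qed.

Lemma profile_M_nonneg (f : R -> R) (lam mu : R) (v M : R -> R) (r : R) :
  (forall t, 0 <= t -> 0 <= f t) -> profile f lam mu v M ->
  0 <= r <= 1 -> 0 <= M r.
Proof.
  intros Hf Hp Hr. generalize (profile_M_le f lam mu v M 0 r Hf Hp ltac:(lra) ltac:(lra)).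
  destruct Hp as (_ & _ & _ & _ & (_ & _ & ->) & _). lra.
Qed.

Lemma profile_v_ge (f : R -> R) (lam mu : R) (v M : R -> R) (r s : R) :
  (forall t, 0 <= t -> 0 <= f t) -> profile f lam mu v M ->
  0 <= r <= s -> s <= 1 -> v s <= v r.
Proof.
  intros Hf Hp Hrs Hs.
  generalize (profile_M_nonneg f lam mu v M); intros HM.
  assert (- v r <= - v s); [|lra].
  pose proof Hp as ((Hlam & Hmu) & (Cv & CM) & Dv & DM & _ & _).
  apply (derivative_nonneg_le (fun r => - v r) (fun r => - - (M r / (mu * r)))); [lra| | |].
  - intros x Hx. apply (is_derive_opp v). apply Dv; lra.
  - intros x _. apply continuity_pt_opp. apply Cv.
  - intros x Hx. rewrite Ropp_involutive.
    apply Rdiv_le_0_compat; [apply HM; try assumption; lra|apply Rmult_lt_0_compat; lra].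
Qed.

Lemma profile_v_le_mu (f : R -> R) (lam mu : R) (v M : R -> R) (r : R) :
  (forall t, 0 <= t -> 0 <= f t) -> profile f lam mu v M ->
  0 <= r <= 1 -> v r <= mu.
Proof.
  intros Hf Hp Hr. generalize (profile_v_ge f lam mu v M 0 r Hf Hp ltac:(lra) ltac:(lra)).
  destruct Hp as (_ & _ & _ & _ & (-> & _) & _). lra.
Qed.

Lemma profile_hits (f : R -> R) (lam mu : R) (v M : R -> R) (c : R) :
  profile f lam mu v M -> 0 < c < mu -> exists r, 0 < r < 1 /\ v r = c.
Proof.
  intros (_ & (Cv & _) & _ & _ & (Hv0 & Hv1 & _) & _) Hc.
  destruct (IVT_gen v 0 1 c Cv) as [r [Hr Hrc]].
  - rewrite Hv0, Hv1, Rmin_right, Rmax_left; lra.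
  - rewrite Rmin_left, Rmax_right in Hr by lra.
    exists r; split; [|exact Hrc].
    split; apply Rnot_le_lt; intros Hle.
    + replace r with 0 in Hrc by lra. lra.
    + replace r with 1 in Hrc by lra. lra.
Qed.

(** In the variable log r the profile descends at speed M / [mu]. A lower bound on M thus bounds the
    descent from below; the companion lemma treats upper bounds. *)
Lemma profile_ln_above (f : R -> R) (lam mu : R) (v M : R -> R) (c r s : R) :
  profile f lam mu v M -> 0 < r <= s -> s <= 1 ->
  (forall x, r < x < s -> c <= M x) ->
  v s + c / mu * ln s <= v r + c / mu * ln r.
Proof.
  intros ((Hlam & Hmu) & (Cv & _) & Dv & _) Hrs Hs HM.
  assert (- (v r + c / mu * ln r) <= - (v s + c / mu * ln s)); [|lra].
  apply (derivative_nonneg_le (fun x => - (v x + c / mu * ln x))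
    (fun x => (M x - c) / (mu * x))); [lra| | |].
  - intros x Hx.
    auto_derive; [split; [eexists; apply Dv; lra|split; [lra|exact I]]|].
    rewrite_Derive (Dv x ltac:(lra)). field. lra.
  - intros x Hx. apply continuity_pt_opp. apply continuity_pt_plus; [apply Cv|].
    apply continuity_pt_scal. eapply is_derive_continuity_pt. apply is_derive_ln; lra.
  - intros x Hx. apply Rdiv_le_0_compat; [generalize (HM x Hx); lra|].
    apply Rmult_lt_0_compat; lra.
Qed.

Lemma profile_ln_below (f : R -> R) (lam mu : R) (v M : R -> R) (c r s : R) :
  profile f lam mu v M -> 0 < r <= s -> s <= 1 ->
  (forall x, r < x < s -> M x <= c) ->
  v r + c / mu * ln r <= v s + c / mu * ln s.
Proof.
  intros ((Hlam & Hmu) & (Cv & _) & Dv & _) Hrs Hs HM.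
  apply (derivative_nonneg_le (fun x => v x + c / mu * ln x)
    (fun x => (c - M x) / (mu * x))); [lra| | |].
  - intros x Hx.
    auto_derive; [split; [eexists; apply Dv; lra|split; [lra|exact I]]|].
    rewrite_Derive (Dv x ltac:(lra)). field. lra.
  - intros x Hx. apply continuity_pt_plus; [apply Cv|].
    apply continuity_pt_scal. eapply is_derive_continuity_pt. apply is_derive_ln; lra.
  - intros x Hx. apply Rdiv_le_0_compat; [generalize (HM x Hx); lra|].
    apply Rmult_lt_0_compat; lra.
Qed.

Lemma source_derive (f df : R -> R) (d T lam mu : R) (v M : R -> R) (r : R) :
  near_gaussian f df d T -> profile f lam mu v M ->
  0 < r < 1 -> T <= v r ->
  is_derive (source f lam mu v) r (lam * r * (2 * mu * f (v r) - df (v r) * M r)).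
Proof.
  intros Hg ((Hlam & Hmu) & (Cv & _) & Dv & _) Hr HT.
  destruct (Hg _ HT) as (Hd & _).
  unfold source.
  auto_derive.
  - split; [|split; [eexists; apply Dv; lra|exact I]]. exists (df (v r)); exact Hd.
  - rewrite_Derive (Dv r Hr).
    rewrite_Derive Hd. field. lra.
Qed.

Lemma source_continuity (f : R -> R) (lam mu : R) (v M : R -> R) :
  continuity f -> profile f lam mu v M -> continuity (source f lam mu v).
Proof.
  intros Cf (_ & (Cv & _) & _). unfold source.
  apply (continuity_mult (fun r => mu * lam * r ^ 2) (fun r => f (v r))).
  - apply (continuity_scal (fun r => r ^ 2)).
    intros x. apply derivable_continuous_pt, derivable_pt_pow.
  - apply (continuity_comp v f); assumption.
Qed.

(** * Logistic comparison and the climb of M to almost 2 *)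

(** Q - 2 M + (2 + d) M^2 / 2 vanishes at 0, and its derivative has the sign of (2 + d) [mu] f(v) -
    f'(v), nonnegative since f'(v) <= (2 + d) v f(v) and v <= [mu]. *)
Lemma source_ge_logistic (f df : R -> R) (d T lam mu : R) (v M : R -> R) (r : R) :
  continuity f -> (forall t, 0 <= t -> 0 <= f t) ->
  0 < d -> 0 < T ->
  near_gaussian f df d T -> profile f lam mu v M ->
  0 < r < 1 -> T <= v r ->
  2 * M r - (2 + d) / 2 * M r ^ 2 <= source f lam mu v r.
Proof.
  intros Cf Hf Hd0 HT0 Hg Hp Hr HT.
  assert (HvT : forall x, 0 < x < r -> T <= v x).
  { intros x Hx. eapply Rle_trans; [exact HT|].
    apply (profile_v_ge f lam mu v M); try assumption; lra. }
  pose proof Hp as ((Hlam & Hmu) & (Cv & CM) & Dv & DM & (_ & _ & HM0) & _).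
  generalize (source_continuity f lam mu v M Cf Hp); intros CQ.
  assert (source f lam mu v 0 - 2 * M 0 + (2 + d) / 2 * M 0 ^ 2 <=
          source f lam mu v r - 2 * M r + (2 + d) / 2 * M r ^ 2) as H.
  2:{ unfold source at 1 in H. rewrite HM0 in H. lra. }
  apply (derivative_nonneg_le
    (fun r => source f lam mu v r - 2 * M r + (2 + d) / 2 * M r ^ 2)
    (fun r => lam * r * M r * ((2 + d) * mu * f (v r) - df (v r)))); [lra| | |].
  - intros x Hx.
    assert (HQ : is_derive (source f lam mu v) x _)
      by (apply (source_derive f df d T lam mu v M x); [assumption..|lra|apply HvT; lra]).
    auto_derive.
    + repeat split; eexists; [exact HQ|apply DM; lra|apply DM; lra].
    + rewrite_Derive HQ.
      rewrite_Derive (DM x ltac:(lra)). field.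
  - intros x _. apply continuity_pt_plus; [apply continuity_pt_minus|].
    + apply CQ.
    + apply continuity_pt_scal, CM.
    + apply continuity_pt_scal. apply (continuity_pt_comp M (fun y => y ^ 2)); [apply CM|].
      apply derivable_continuous_pt, derivable_pt_pow.
  - intros x Hx. destruct (Hg _ (HvT x Hx)) as (_ & Hfp & _ & Hup).
    apply Rmult_le_pos.
    + apply Rmult_le_pos; [apply Rmult_le_pos; lra|].
      apply (profile_M_nonneg f lam mu v M); try assumption; lra.
    + assert (v x <= mu) by (apply (profile_v_le_mu f lam mu v M); try assumption; lra).
      assert ((2 + d) * v x * f (v x) <= (2 + d) * mu * f (v x)); [|lra].
      apply Rmult_le_compat_r; [lra|]. apply Rmult_le_compat_l; lra.
Qed.

(** The reverse comparison needs v close to [mu]: then f'(v) >= (2 - d)(1 - d) [mu] f(v), and (2 -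
    d)(1 - d) >= 2 - 3d. *)
Lemma source_le_logistic (f df : R -> R) (d T lam mu : R) (v M : R -> R) (r : R) :
  continuity f -> (forall t, 0 <= t -> 0 <= f t) ->
  0 < d < 1 -> T <= (1 - d) * mu ->
  near_gaussian f df d T -> profile f lam mu v M ->
  0 < r < 1 -> (1 - d) * mu <= v r ->
  source f lam mu v r <= 2 * M r - (2 - 3 * d) / 2 * M r ^ 2.
Proof.
  intros Cf Hf Hd0 HTmu Hg Hp Hr Hvr.
  assert (HvT : forall x, 0 < x < r -> (1 - d) * mu <= v x).
  { intros x Hx. eapply Rle_trans; [exact Hvr|].
    apply (profile_v_ge f lam mu v M); try assumption; lra. }
  pose proof Hp as ((Hlam & Hmu) & (Cv & CM) & Dv & DM & (_ & _ & HM0) & _).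
  generalize (source_continuity f lam mu v M Cf Hp); intros CQ.
  assert (- source f lam mu v 0 + 2 * M 0 - (2 - 3 * d) / 2 * M 0 ^ 2 <=
          - source f lam mu v r + 2 * M r - (2 - 3 * d) / 2 * M r ^ 2) as H.
  2:{ unfold source at 1 in H. rewrite HM0 in H. lra. }
  apply (derivative_nonneg_le
    (fun r => - source f lam mu v r + 2 * M r - (2 - 3 * d) / 2 * M r ^ 2)
    (fun r => lam * r * M r * (df (v r) - (2 - 3 * d) * mu * f (v r)))); [lra| | |].
  - intros x Hx.
    assert (HQ : is_derive (source f lam mu v) x _)
      by (apply (source_derive f df d T lam mu v M x);
          [assumption..|lra|generalize (HvT x Hx); lra]).
    auto_derive.
    + repeat split; eexists; [exact HQ|apply DM; lra|apply DM; lra].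
    + rewrite_Derive HQ.
      rewrite_Derive (DM x ltac:(lra)). field.
  - intros x _. apply continuity_pt_minus; [apply continuity_pt_plus|].
    + apply continuity_pt_opp, CQ.
    + apply continuity_pt_scal, CM.
    + apply continuity_pt_scal. apply (continuity_pt_comp M (fun y => y ^ 2)); [apply CM|].
      apply derivable_continuous_pt, derivable_pt_pow.
  - intros x Hx. generalize (HvT x Hx); intros Hvx.
    destruct (Hg (v x)) as (_ & Hfp & Hlow & _); [lra|].
    apply Rmult_le_pos.
    + apply Rmult_le_pos; [apply Rmult_le_pos; lra|].
      apply (profile_M_nonneg f lam mu v M); try assumption; lra.
    + assert ((2 - 3 * d) * mu * f (v x) <= (2 - d) * v x * f (v x)); [|lra].
      apply Rmult_le_compat_r; [lra|].
      apply Rle_trans with ((2 - d) * ((1 - d) * mu)); [|apply Rmult_le_compat_l; lra].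
      nra.
Qed.

(* [v + M / (3 d mu)] is nondecreasing, since [D M >= 3 d M] as long as
   [M <= 2 - 4 d]. *)
Lemma v_stays_near_mu (f df : R -> R) (d T lam mu : R) (v M : R -> R) (r : R) :
  continuity f -> (forall t, 0 <= t -> 0 <= f t) ->
  0 < d -> 0 < T ->
  near_gaussian f df d T -> profile f lam mu v M ->
  0 < r < 1 -> T <= v r -> M r <= 2 - 4 * d ->
  mu - M r / (3 * d * mu) <= v r.
Proof.
  intros Cf Hf Hd0 HT0 Hg Hp Hr HT HMr.
  pose proof Hp as ((Hlam & Hmu) & (Cv & CM) & Dv & DM & (Hv0 & _ & HM0) & _).
  assert (v 0 + / (3 * d * mu) * M 0 <= v r + / (3 * d * mu) * M r) as H.
  2:{ rewrite HM0, Hv0 in H. unfold Rdiv. lra. }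
  apply (derivative_nonneg_le (fun r => v r + / (3 * d * mu) * M r)
    (fun r => (source f lam mu v r - 3 * d * M r) / (3 * d * mu * r))); [lra| | |].
  - intros x Hx. auto_derive.
    + repeat split; eexists; [apply Dv|apply DM]; lra.
    + rewrite_Derive (Dv x ltac:(lra)).
      rewrite_Derive (DM x ltac:(lra)).
      unfold source. field. lra.
  - intros x _. apply continuity_pt_plus; [apply Cv|]. apply continuity_pt_scal, CM.
  - intros x Hx. apply Rdiv_le_0_compat.
    2:{ apply Rmult_lt_0_compat; [|lra]. apply Rmult_lt_0_compat; lra. }
    assert (T <= v x).
    { eapply Rle_trans; [exact HT|]. apply (profile_v_ge f lam mu v M); try assumption; lra. }
    assert (M x <= M r) by (apply (profile_M_le f lam mu v M); try assumption; lra).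
    assert (0 <= M x) by (apply (profile_M_nonneg f lam mu v M); try assumption; lra).
    assert (2 * M x - (2 + d) / 2 * M x ^ 2 <= source f lam mu v x)
      by (apply (source_ge_logistic f df d T lam mu v M); try assumption; lra).
    (* At the threshold M = 2 - 4d one has (2 + d) M / 2 = 2 - 3d - 2d^2, so the bracket is still
       positive. *)
    assert (0 <= M x * (2 - 3 * d - (2 + d) / 2 * M x)); [|lra].
    apply Rmult_le_pos; [assumption|]. nra.
Qed.
(** M must reach 2 - 4d before v falls to [T], because up to then v loses at most 2/3, which is
    below both [mu] / 2 and d [mu]. *)
Lemma first_bubble_radius (f df : R -> R) (d T lam mu : R) (v M : R -> R) :
  continuity f -> (forall t, 0 <= t -> 0 <= f t) ->
  0 < d <= 1 / 100 -> 0 < T -> T <= mu / 2 -> 1 <= d * mu ->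
  near_gaussian f df d T -> profile f lam mu v M ->
  exists r, 0 < r < 1 /\ M r = 2 - 4 * d /\ (1 - d) * mu <= v r /\
    3 * d <= source f lam mu v r <= 14 * d.
Proof.
  intros Cf Hf Hd HT0 HTmu Hdmu Hg Hp.
  pose proof Hp as ((Hlam & Hmu) & (Cv & CM) & _ & _ & (_ & _ & HM0) & _).
  assert (Hmu1 : 100 <= mu) by nra.
  assert (Hdrop : forall m, m <= 2 -> m / (3 * d * mu) <= 2 / 3).
  { intros m Hm. apply Rle_div_l; [nra|]. lra. }
  destruct (profile_hits f lam mu v M T Hp) as [rT [HrT HvT]]; [lra|].
  assert (2 - 4 * d <= M rT) as HMT.
  { apply Rnot_lt_le; intros Hlt.
    assert (mu - M rT / (3 * d * mu) <= v rT)
      by (apply (v_stays_near_mu f df d T lam mu v M); try assumption; lra).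
    generalize (Hdrop (M rT)). lra. }
  destruct (IVT_gen M 0 rT (2 - 4 * d) CM) as [r [Hr HMr]].
  { rewrite HM0, Rmin_left, Rmax_right; lra. }
  rewrite Rmin_left, Rmax_right in Hr by lra.
  assert (0 < r).
  { apply Rnot_le_lt; intros Hle. replace r with 0 in HMr by lra. lra. }
  assert (T <= v r).
  { rewrite <- HvT. apply (profile_v_ge f lam mu v M); try assumption; lra. }
  assert (mu - M r / (3 * d * mu) <= v r)
    by (apply (v_stays_near_mu f df d T lam mu v M); try assumption; lra).
  assert ((1 - d) * mu <= v r) by (generalize (Hdrop (M r)); lra).
  assert (2 * M r - (2 + d) / 2 * M r ^ 2 <= source f lam mu v r)
    by (apply (source_ge_logistic f df d T lam mu v M); try assumption; lra).
  assert (source f lam mu v r <= 2 * M r - (2 - 3 * d) / 2 * M r ^ 2)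
    by (apply (source_le_logistic f df d T lam mu v M); try assumption; nra).
  (* At M = 2 - 4d the two logistic bounds on Q are (2 - 4d)(3d + 2d^2) and (2 - 4d)(7d - 6d^2). *)
  rewrite HMr in *.
  exists r. repeat split; try assumption; try lra; nra.
Qed.

(** * Behaviour of M and Q after the bubble *)

(** D (M + 2 Q) = Q (5 - 2 M f'(v) / ([mu] f(v))), and in this range M f'(v) / ([mu] f(v)) is at
    least about 2 (3/4) 2 = 3 > 5/2. So the further gain of M is paid for by the small Q(r1). *)
Lemma M_le_after_bubble (f df : R -> R) (d T lam mu : R) (v M : R -> R) (r1 r : R) :
  continuity f -> (forall t, 0 <= t -> 0 <= f t) ->
  0 < d <= 1 / 100 -> T <= 3 / 4 * mu ->
  near_gaussian f df d T -> profile f lam mu v M ->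
  0 < r1 <= r -> r < 1 -> M r1 = 2 - 4 * d -> 3 / 4 * mu <= v r ->
  M r + 2 * source f lam mu v r <= M r1 + 2 * source f lam mu v r1.
Proof.
  intros Cf Hf Hd HTmu Hg Hp Hr1 Hr HM1 Hvr.
  pose proof Hp as ((Hlam & Hmu) & (Cv & CM) & Dv & DM & _ & _).
  generalize (source_continuity f lam mu v M Cf Hp); intros CQ.
  assert (Hvx : forall x, r1 < x < r -> 3 / 4 * mu <= v x).
  { intros x Hx. eapply Rle_trans; [exact Hvr|].
    apply (profile_v_ge f lam mu v M); try assumption; lra. }
  assert (- (M r1 + 2 * source f lam mu v r1) <= - (M r + 2 * source f lam mu v r)); [|lra].
  apply (derivative_nonneg_le (fun x => - (M x + 2 * source f lam mu v x))
    (fun x => lam * x * (2 * (df (v x) * M x) - 5 * (mu * f (v x))))); [lra| | |].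
  - intros x Hx.
    assert (HQ : is_derive (source f lam mu v) x _)
      by (apply (source_derive f df d T lam mu v M x);
          [assumption..|lra|generalize (Hvx x Hx); lra]).
    auto_derive.
    + repeat split; eexists; [apply DM; lra|exact HQ].
    + rewrite_Derive HQ.
      rewrite_Derive (DM x ltac:(lra)). field.
  - intros x _. apply continuity_pt_opp, continuity_pt_plus; [apply CM|].
    apply continuity_pt_scal, CQ.
  - intros x Hx. generalize (Hvx x Hx); intros Hv.
    destruct (Hg (v x)) as (_ & Hfp & Hlow & _); [lra|].
    assert (HM : 2 - 4 * d <= M x).
    { rewrite <- HM1. apply (profile_M_le f lam mu v M); try assumption; lra. }
    apply Rmult_le_pos; [apply Rmult_le_pos; lra|].
    assert ((2 - d) * (3 / 4 * (mu * f (v x))) <= df (v x)) as Hdf.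
    { eapply Rle_trans; [|exact Hlow]. rewrite Rmult_assoc.
      apply Rmult_le_compat_l; [lra|]. nra. }
    assert (0 < mu * f (v x)) by (apply Rmult_lt_0_compat; lra).
    assert ((2 - d) * (3 / 4 * (mu * f (v x))) * (2 - 4 * d) <= df (v x) * M x).
    { apply Rmult_le_compat; try lra. apply Rmult_le_pos; lra. }
    assert (5 / 2 * (mu * f (v x)) <= (2 - d) * (3 / 4) * (2 - 4 * d) * (mu * f (v x))).
    { apply Rmult_le_compat_r; [lra|]. nra. }
    lra.
Qed.

Lemma ln_source (f : R -> R) (lam mu : R) (v : R -> R) (r : R) :
  0 < lam -> 0 < mu -> 0 < r -> 0 < f (v r) ->
  ln (source f lam mu v r) = ln mu + ln lam + 2 * ln r + ln (f (v r)).
Proof.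
  intros Hlam Hmu Hr Hf. unfold source.
  assert (0 < mu * lam) by (apply Rmult_lt_0_compat; assumption).
  assert (0 < r ^ 2) by (apply pow_lt; assumption).
  rewrite ln_mult; [|apply Rmult_lt_0_compat; assumption|assumption].
  rewrite ln_mult by assumption.
  rewrite ln_mult by assumption.
  simpl. rewrite Rmult_1_r, ln_mult by assumption. lra.
Qed.

(** Beyond [r1] the speed of descent is at least (2 - 4d) / [mu]; the factor 1 + 3d comes from (1 +
    3d)(2 - 4d) >= 2. *)
Lemma ln_ratio_le (f : R -> R) (d lam mu : R) (v M : R -> R) (r1 r s : R) :
  (forall t, 0 <= t -> 0 <= f t) -> 0 < d <= 1 / 100 ->
  profile f lam mu v M -> 0 < r1 <= r -> r <= s -> s <= 1 -> M r1 = 2 - 4 * d ->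
  2 * (ln s - ln r) <= (1 + 3 * d) * mu * (v r - v s).
Proof.
  intros Hf Hd Hp Hr1 Hr Hs HM1.
  pose proof Hp as ((Hlam & Hmu) & _).
  assert (v s + (2 - 4 * d) / mu * ln s <= v r + (2 - 4 * d) / mu * ln r) as H.
  { apply (profile_ln_above f lam mu v M); try assumption; [lra|].
    intros x Hx. rewrite <- HM1. apply (profile_M_le f lam mu v M); try assumption; lra. }
  assert (0 <= ln s - ln r).
  { assert (ln r <= ln s); [|lra].
    destruct (Req_dec r s) as [->|Hne]; [lra|]. left; apply ln_increasing; lra. }
  assert ((2 - 4 * d) * (ln s - ln r) <= mu * (v r - v s)) as H1.
  { apply Rmult_le_reg_l with (/ mu); [apply Rinv_0_lt_compat; lra|].
    replace (/ mu * (mu * (v r - v s))) with (v r - v s) by (field; lra).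
    unfold Rdiv in H. lra. }
  apply Rle_trans with ((1 + 3 * d) * ((2 - 4 * d) * (ln s - ln r))).
  - rewrite <- Rmult_assoc. apply Rmult_le_compat_r; [assumption|]. nra.
  - rewrite Rmult_assoc. apply Rmult_le_compat_l; lra.
Qed.

(** With v1 = v(r1), the change of ln Q from [r1] to r is at most (v1 - v) ((1 + 3d) [mu] - (1 -
    d/2)(v1 + v)): the first term bounds the gain from r^2, the second the loss in ln f. Here v1 - v
    >= [mu] / 8, and v1 + v >= (1 - d + e) [mu] makes the bracket at most - e [mu] / 2, as 10 d <= e
    absorbs the errors in d. *)
Lemma source_decay (f df : R -> R) (d e T lam mu : R) (v M : R -> R) (r1 r : R) :
  (forall t, 0 <= t -> 0 <= f t) ->
  0 < d <= 1 / 100 -> 10 * d <= e <= 1 -> T <= e * mu ->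
  near_gaussian f df d T -> profile f lam mu v M ->
  0 < r1 <= r -> r < 1 -> M r1 = 2 - 4 * d -> (1 - d) * mu <= v r1 ->
  source f lam mu v r1 <= 1 -> e * mu <= v r <= 3 / 4 * mu ->
  source f lam mu v r <= exp (- (e * mu ^ 2 / 16)).
Proof.
  intros Hf Hd He HTmu Hg Hp Hr1 Hr HM1 Hv1 HQ1 Hvr.
  pose proof Hp as ((Hlam & Hmu) & (Cv & CM) & Dv & DM & _ & _).
  assert (Hv1mu : v r1 <= mu) by (apply (profile_v_le_mu f lam mu v M); try assumption; lra).
  generalize (ln_ratio_le f d lam mu v M r1 r1 r Hf Hd Hp ltac:(lra) ltac:(lra) ltac:(lra) HM1).
  intros Hln.
  assert (Hv : v r <= v r1) by nra.
  assert (HTv1 : T <= v r1) by lra.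
  assert (Hf1 : 0 < f (v r1)) by (apply Hg; exact HTv1).
  assert (Hfr : 0 < f (v r)) by (apply Hg; lra).
  generalize (near_gaussian_ln f df d T (v r) (v r1) Hg ltac:(lra)). intros [Hgl _].
  assert (HQ : forall x, 0 < x -> 0 < f (v x) -> 0 < source f lam mu v x).
  { intros x Hx Hfx. unfold source. apply Rmult_lt_0_compat; [|exact Hfx].
    apply Rmult_lt_0_compat; [apply Rmult_lt_0_compat; lra|]. apply pow_lt; exact Hx. }
  rewrite <- (exp_ln (source f lam mu v r)) by (apply HQ; [lra|assumption]).
  assert (ln (source f lam mu v r1) <= 0) as HlnQ1.
  { rewrite <- ln_1. apply ln_le; [apply HQ; [lra|assumption]|exact HQ1]. }
  rewrite ln_source in HlnQ1 by lra.
  assert (ln (source f lam mu v r) <= - (e * mu ^ 2 / 16)) as H.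
  2:{ destruct H as [H| ->]; [left; apply exp_increasing; exact H|lra]. }
  rewrite ln_source by lra.
  assert ((v r1 - v r) * ((1 + 3 * d) * mu - (1 - d / 2) * (v r1 + v r))
          <= - (e * mu ^ 2 / 16)); [|lra].
  assert ((1 + 3 * d) * mu - (1 - d / 2) * (v r1 + v r) <= - (e / 2 * mu)) as Hb.
  { assert ((1 - d / 2) * ((1 - d + e) * mu) <= (1 - d / 2) * (v r1 + v r))
      by (apply Rmult_le_compat_l; lra).
    assert (((1 + 3 * d) - (1 - d / 2) * (1 - d + e)) * mu <= - (e / 2) * mu); [|lra].
    apply Rmult_le_compat_r; [lra|]. nra. }
  assert (mu / 8 <= v r1 - v r) as Hdiff by nra.
  assert (mu / 8 * (e / 2 * mu) <=
    (v r1 - v r) * - ((1 + 3 * d) * mu - (1 - d / 2) * (v r1 + v r))).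
  { apply Rmult_le_compat; try lra. apply Rmult_le_pos; lra. }
  lra.
Qed.

(** * Quantitative estimate for one profile *)

(** For fixed [e] all smallness conditions hold once [mu] is large, and d = e/100 lets a few dozen
    errors of size d fit into e. The bound on ln [lam] comes from solving the formula for ln
    Q(r1). *)
Lemma single_bubble_estimate (f df : R -> R) (d e T lam mu : R) (v M : R -> R) :
  continuity f -> (forall t, 0 <= t -> 0 <= f t) ->
  0 < e <= 1 / 2 -> d = e / 100 -> 0 < T -> T <= e * mu -> 1 <= d * mu ->
  exp (- (e * mu ^ 2 / 16)) * mu ^ 2 <= d ->
  Rabs (ln (f T)) + 2 * T ^ 2 <= d / 2 * mu ^ 2 ->
  near_gaussian f df d T -> profile f lam mu v M ->
  (exists r, 0 < r < 1 /\ v r = e * mu /\ Rabs (M r - 2) <= e) /\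
  Rabs (ln lam) <= 2 * e * mu ^ 2.
Proof.
  intros Cf Hf He Hde HT0 HTmu Hdmu Hexp HfT Hg Hp.
  assert (Hd : 0 < d <= 1 / 100) by lra.
  pose proof Hp as ((Hlam & Hmu) & (Cv & CM) & Dv & DM & (Hv0 & Hv1 & HM0) & _).
  assert (Hemu : 0 < e * mu <= mu / 2).
  { split; [apply Rmult_lt_0_compat; lra|].
    replace (mu / 2) with (1 / 2 * mu) by field. apply Rmult_le_compat_r; lra. }
  assert (Hdmu2 : d * mu <= 1 / 100 * mu) by (apply Rmult_le_compat_r; lra).
  destruct (first_bubble_radius f df d T lam mu v M Cf Hf Hd HT0 ltac:(lra) Hdmu Hg Hp)
    as (r1 & Hr1 & HM1 & Hvr1 & HQ1).
  (* Height 3 [mu] / 4 separates the range where M + 2 Q is controlled from the one where Q is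
     exponentially small. *)
  destruct (profile_hits f lam mu v M (3 / 4 * mu) Hp) as (rc & Hrc & Hvc); [lra|].
  destruct (profile_hits f lam mu v M (e * mu) Hp) as (r2 & Hr2 & Hv2); [lra|].
  assert (Hord : forall x y, 0 < x < 1 -> 0 < y < 1 -> v y < v x -> x <= y).
  { intros x y Hx Hy Hxy. apply Rnot_lt_le; intros Hlt.
    assert (v x <= v y) by (apply (profile_v_ge f lam mu v M); try assumption; lra). lra. }
  assert (r1 <= rc) by (apply Hord; try assumption; lra).
  assert (rc <= r2) by (apply Hord; try assumption; lra).
  assert (Hv1mu : v r1 <= mu) by (apply (profile_v_le_mu f lam mu v M); try assumption; lra).
  assert (Hmono : forall x y, 0 <= x <= y -> y <= 1 -> M x <= M y)
    by (intros; apply (profile_M_le f lam mu v M); assumption).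
  assert (0 <= source f lam mu v rc).
  { unfold source. apply Rmult_le_pos.
    - apply Rmult_le_pos; [apply Rmult_le_pos; lra|apply pow2_ge_0].
    - apply Hf; lra. }
  assert (HMc : M rc + 2 * source f lam mu v rc <= M r1 + 2 * source f lam mu v r1)
    by (apply (M_le_after_bubble f df d T lam mu v M r1 rc); try assumption; lra).
  set (A := exp (- (e * mu ^ 2 / 16))) in *.
  (* Between [rc] and [r2], D M = Q <= [A], so M grows at most by [A] times the length in log r. *)
  assert (A * ln rc - M rc <= A * ln r2 - M r2) as HMA.
  { apply (derivative_nonneg_le (fun x => A * ln x - M x)
      (fun x => (A - source f lam mu v x) / x)); [lra| | |].
    - intros x Hx. auto_derive.
      + repeat split; [lra|eexists; apply DM; lra].
      + rewrite_Derive (DM x ltac:(lra)). unfold source. field. lra.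
    - intros x Hx. apply continuity_pt_minus; [|apply CM].
      apply continuity_pt_scal. eapply is_derive_continuity_pt. apply is_derive_ln; lra.
    - intros x Hx. apply Rdiv_le_0_compat; [|lra].
      assert (source f lam mu v x <= A); [|lra].
      apply (source_decay f df d e T lam mu v M r1 x); try assumption; try lra.
      rewrite <- Hvc, <- Hv2.
      split; apply (profile_v_ge f lam mu v M); try assumption; lra. }
  generalize (ln_ratio_le f d lam mu v M r1 rc r2 Hf Hd Hp ltac:(lra) ltac:(lra) ltac:(lra) HM1).
  intros Hlnc2.
  (* M(rc) <= 2 - 4d + 28d, since Q(r1) <= 14d; the length in log r up to [r2] is at most [mu]^2,
     which adds at most [A] [mu]^2 <= d. *)
  assert (HM2 : M r2 <= 2 + 25 * d).
  { assert (A * (ln r2 - ln rc) <= A * mu ^ 2); [|lra].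
    apply Rmult_le_compat_l; [left; apply exp_pos|].
    rewrite Hvc, Hv2 in Hlnc2.
    assert ((1 + 3 * d) * (3 / 4 - e) * mu ^ 2 <= 2 * mu ^ 2)
      by (apply Rmult_le_compat_r; [apply pow2_ge_0|nra]).
    lra. }
  assert (HM2' : 2 - 4 * d <= M r2) by (rewrite <- HM1; apply Hmono; lra).
  split.
  { exists r2. repeat split; try lra. apply Rabs_le. lra. }
  (* The descent from [r1] to 1 bounds - ln r1 from above. The lower bound uses only the descent to
     [r2], where M <= 2 + 25d is known; stopping at height e [mu] costs e [mu]^2. *)
  generalize (ln_ratio_le f d lam mu v M r1 r1 1 Hf Hd Hp ltac:(lra) ltac:(lra) ltac:(lra) HM1).
  rewrite Hv1, ln_1. intros Hln1.
  assert (v r1 + (2 + 25 * d) / mu * ln r1 <= v r2 + (2 + 25 * d) / mu * ln r2) as Hln2.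
  { apply (profile_ln_below f lam mu v M); try assumption; try lra.
    intros x Hx. eapply Rle_trans; [|exact HM2]. apply Hmono; lra. }
  assert (Hlnr2 : ln r2 <= 0) by (rewrite <- ln_1; apply ln_le; lra).
  assert (mu * (v r1 - v r2) <= (2 + 25 * d) * - ln r1) as Hln3.
  { apply Rle_trans with ((2 + 25 * d) * (ln r2 - ln r1)).
    - apply Rmult_le_reg_l with (/ mu); [apply Rinv_0_lt_compat; lra|].
      replace (/ mu * (mu * (v r1 - v r2))) with (v r1 - v r2) by (field; lra).
      unfold Rdiv in Hln2. lra.
    - apply Rmult_le_compat_l; lra. }
  assert (Hf1 : 0 < f (v r1)) by (apply Hg; lra).
  assert (HlnQ : ln (source f lam mu v r1) = _) by (apply ln_source; lra).
  assert (Hmu2 : mu <= d * mu ^ 2).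
  { replace (d * mu ^ 2) with (d * mu * mu) by ring.
    rewrite <- (Rmult_1_l mu) at 1. apply Rmult_le_compat_r; lra. }
  assert (Hinvd : / d <= mu).
  { apply Rmult_le_reg_l with d; [lra|]. rewrite Rinv_r by lra. exact Hdmu. }
  assert (HlnQle : ln (source f lam mu v r1) <= 0) by (rewrite <- ln_1; apply ln_le; lra).
  assert (Hlnid : forall x, 0 < x -> ln x <= x).
  { intros x Hx. rewrite <- (ln_exp x) at 2. apply ln_le; [exact Hx|].
    generalize (exp_ineq1_le x). lra. }
  (* Q(r1) >= 3d, and - ln d <= 1/d <= [mu] <= d [mu]^2. *)
  assert (HlnQge : - (d * mu ^ 2) <= ln (source f lam mu v r1)).
  { apply Rle_trans with (ln d); [|apply ln_le; lra].
    generalize (Hlnid (/ d) ltac:(apply Rinv_0_lt_compat; lra)).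
    rewrite ln_Rinv by lra. lra. }
  assert (Hlnmu : 0 <= ln mu <= d * mu ^ 2).
  { split; [rewrite <- ln_1; apply ln_le; lra|]. generalize (Hlnid mu Hmu). lra. }
  generalize (near_gaussian_ln f df d T T (v r1) Hg ltac:(lra)). intros [Hgl Hgu].
  assert (Hsq : (1 - 2 * d) * mu ^ 2 <= v r1 ^ 2 <= mu ^ 2).
  { split; [|apply pow_incr; lra].
    apply Rle_trans with (((1 - d) * mu) ^ 2); [|apply pow_incr; lra].
    rewrite Rpow_mult_distr. apply Rmult_le_compat_r; [apply pow2_ge_0|].
    generalize (pow2_ge_0 d). lra. }
  assert (HT2 : 0 <= T ^ 2) by apply pow2_ge_0.
  generalize (Rle_abs (ln (f T))) (Rabs_maj2 (ln (f T))). intros Ha1 Ha2.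
  assert (Hlnf : (1 - 4 * d) * mu ^ 2 <= ln (f (v r1)) <= (1 + 2 * d) * mu ^ 2).
  { assert (d * v r1 ^ 2 <= d * mu ^ 2) by (apply Rmult_le_compat_l; lra).
    assert (0 <= d * T ^ 2) by (apply Rmult_le_pos; lra).
    assert (d * T ^ 2 <= 1 * T ^ 2) by (apply Rmult_le_compat_r; lra). lra. }
  assert (Hup : 2 * - ln r1 <= (1 + 3 * d) * mu ^ 2).
  { eapply Rle_trans; [|apply Rle_trans with (1 := Hln1)]; [lra|].
    replace ((1 + 3 * d) * mu ^ 2) with ((1 + 3 * d) * mu * mu) by ring.
    apply Rmult_le_compat_l; [apply Rmult_le_pos; lra|lra]. }
  assert (Hlow : (1 - e - 14 * d) * mu ^ 2 <= 2 * - ln r1).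
  { assert ((1 - d - e) * mu ^ 2 <= (2 + 25 * d) * - ln r1) as H3.
    { eapply Rle_trans; [|exact Hln3]. rewrite Hv2.
      replace ((1 - d - e) * mu ^ 2) with (mu * ((1 - d) * mu - e * mu)) by ring.
      apply Rmult_le_compat_l; lra. }
    assert ((1 + 25 / 2 * d) * ((1 - e - 14 * d) * mu ^ 2) <= (1 - d - e) * mu ^ 2).
    { rewrite <- Rmult_assoc. apply Rmult_le_compat_r; [apply pow2_ge_0|].
      assert (0 <= d * d) by (apply Rmult_le_pos; lra).
      assert (0 <= d * e) by (apply Rmult_le_pos; lra). lra. }
    apply Rmult_le_reg_l with (1 + 25 / 2 * d); lra. }
  rewrite HlnQ in HlnQle, HlnQge.
  (* Collecting the bounds, ln [lam] lies between - (e + 18d) [mu]^2 and 7d [mu]^2. *)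
  apply Rabs_le. rewrite Hde in *.
  assert (0 <= e * mu ^ 2) by (apply Rmult_le_pos; [lra|apply pow2_ge_0]).
  split; lra.
Qed.

(** * Application to f(t) = h(t) exp(t^2) *)

(** The derivative is (2 t h + h') exp(t^2), and |h'| <= d t h for large t. [Rmax 0 t] freezes f at
    its value at 0 on negative arguments, where nothing is known about [h]. *)
Lemma nonlin_near_gaussian (h h' : R -> R) (t0 d : R) :
  C1_on (fun t => 0 <= t) h h' -> 0 < t0 -> (forall t, t0 <= t -> 0 < h t) ->
  is_lim (fun t => h' t / (t * h t)) p_infty 0 -> 0 < d ->
  exists T, 0 < T /\
    near_gaussian (fun t => nonlin h (Rmax 0 t))
      (fun t => (2 * t * h t + h' t) * exp (t ^ 2)) d T.
Proof.
  intros HC Ht0 Hpos Hlim Hd.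
  apply is_lim_spec in Hlim. destruct (Hlim (mkposreal d Hd)) as [N HN]. simpl in HN.
  exists (Rmax t0 (N + 1)).
  generalize (Rmax_l t0 (N + 1)) (Rmax_r t0 (N + 1)); intros HT1 HT2.
  split; [lra|]. intros t Ht.
  assert (Hht : 0 < h t) by (apply Hpos; lra).
  assert (Hexp : 0 < exp (t ^ 2)) by apply exp_pos.
  assert (Hloc : locally t (fun y => 0 <= y)).
  { apply (filter_imp (fun y => 0 < y)); [intros; lra|]. apply (open_gt 0); lra. }
  split; [|split].
  - apply (is_derive_ext_loc (nonlin h)).
    { revert Hloc. apply filter_imp. intros y Hy. rewrite Rmax_right by exact Hy. reflexivity. }
    assert (Hh : is_derive h t (h' t)).
    { apply (D_in_is_derive (fun t => 0 <= t)); [exact Hloc|]. apply HC; lra. }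
    unfold nonlin. auto_derive; [exists (h' t); exact Hh|].
    rewrite_Derive Hh. ring_simplify. replace (t * (t * 1)) with (t ^ 2) by ring. ring.
  - rewrite Rmax_right by lra. apply Rmult_lt_0_compat; assumption.
  - rewrite Rmax_right by lra. unfold nonlin.
    assert (Habs : Rabs (h' t / (t * h t) - 0) < d) by (apply HN; lra).
    rewrite Rminus_0_r in Habs. apply Rabs_def2 in Habs.
    assert (Hth : 0 < t * h t) by (apply Rmult_lt_0_compat; lra).
    assert (Hh' : h' t = h' t / (t * h t) * (t * h t)) by (field; lra).
    rewrite <- !(Rmult_assoc _ (h t)).
    split; apply Rmult_le_compat_r; try lra; rewrite Hh'.
    + assert (- d * (t * h t) <= h' t / (t * h t) * (t * h t))
        by (apply Rmult_le_compat_r; lra). lra.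
    + assert (h' t / (t * h t) * (t * h t) <= d * (t * h t))
        by (apply Rmult_le_compat_r; lra). lra.
Qed.

Lemma nonlin_extension_continuity (h h' : R -> R) :
  C1_on (fun t => 0 <= t) h h' -> continuity (fun t => nonlin h (Rmax 0 t)).
Proof.
  intros HC.
  assert (Cid : continuity (Rmax 0)).
  { intros x e He. exists e; split; [exact He|]. intros y [_ Hy]. simpl in *.
    unfold Rdist in *. eapply Rle_lt_trans; [apply Rmax0_lipschitz|exact Hy]. }
  apply (continuity_mult (fun t => h (Rmax 0 t)) (fun t => exp (Rmax 0 t ^ 2))).
  - apply (continue_in_retract (fun t => 0 <= t) (Rmax 0)).
    + intros x; apply Rmax_l.
    + apply Rmax0_lipschitz.
    + intros x Hx. apply (cont_deriv h h' _ x). apply HC; exact Hx.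
  - apply (continuity_comp (Rmax 0) (fun t => exp (t ^ 2))); [exact Cid|].
    intros x. apply derivable_continuous_pt. exists (2 * x * exp (x ^ 2)).
    apply is_derive_Reals. auto_derive; [exact I|].
    replace (x * (x * 1)) with (x ^ 2) by ring. ring.
Qed.

(** With x = e [mu]^2 / 32, exp(2x) >= x^2, while x^2 d = (e^2 d [mu]^2 / 1024) [mu]^2 >= [mu]^2;
    this explains the constant 1024. *)
Lemma exp_quadratic_decay (e d mu : R) :
  0 < e -> 0 < d -> 1 <= mu -> 1024 / (e ^ 2 * d) <= mu ->
  exp (- (e * mu ^ 2 / 16)) * mu ^ 2 <= d.
Proof.
  intros He Hd Hmu1 Hmu.
  set (x := e * mu ^ 2 / 32).
  assert (Hmu2 : mu <= mu ^ 2) by nra.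
  assert (Hx : 0 < x) by (unfold x; apply Rdiv_lt_0_compat; [apply Rmult_lt_0_compat|]; lra).
  assert (Hexp : x <= exp x) by (generalize (exp_ineq1_le x); lra).
  assert (Hexp2 : x ^ 2 <= exp (e * mu ^ 2 / 16)).
  { replace (e * mu ^ 2 / 16) with (x + x) by (unfold x; field).
    rewrite exp_plus. simpl. rewrite Rmult_1_r. apply Rmult_le_compat; lra. }
  rewrite exp_Ropp.
  apply Rmult_le_reg_l with (exp (e * mu ^ 2 / 16)); [apply exp_pos|].
  rewrite <- Rmult_assoc, Rinv_r, Rmult_1_l
    by (apply Rgt_not_eq, exp_pos).
  apply Rle_trans with (x ^ 2 * d); [|apply Rmult_le_compat_r; lra].
  assert (He2 : 0 < e ^ 2 * d) by (apply Rmult_lt_0_compat; [apply pow_lt|]; lra).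
  assert (1024 <= mu ^ 2 * (e ^ 2 * d)).
  { apply Rle_trans with (mu * (e ^ 2 * d)).
    - apply Rle_div_l in Hmu; lra.
    - apply Rmult_le_compat_r; lra. }
  replace (x ^ 2 * d) with (mu ^ 2 * (e ^ 2 * d) / 1024 * mu ^ 2) by (unfold x; field).
  rewrite <- (Rmult_1_l (mu ^ 2)) at 1. apply Rmult_le_compat_r; lra.
Qed.

(** The parameter [e] serves both as the exact relative height at the chosen radius and as the
    tolerance, so one sequence of values of [e] tending to 0 settles both limits. *)
Lemma bubble_estimate (h h' : R -> R) (t0 e : R) :
  C1_on (fun t => 0 <= t) h h' -> (forall t, 0 <= t -> 0 <= h t) ->
  0 < t0 -> (forall t, t0 <= t -> 0 < h t) ->
  is_lim (fun t => h' t / (t * h t)) p_infty 0 -> 0 < e <= 1 / 2 ->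
  exists mu0, forall lam mu u, mu0 < mu -> solution (nonlin h) lam mu u ->
    (exists r, 0 < r < 1 /\ u r / mu = e /\
       Rabs (2 * mu * RInt (fun s => lam * nonlin h (u s) * s) 0 r - 4) <= 2 * e) /\
    Rabs (ln (1 / lam) / mu ^ 2) <= 2 * e.
Proof.
  intros HC Hh0 Ht0 Hhpos Hlim He.
  remember (e / 100) as d eqn:Hde. assert (Hd : 0 < d) by lra.
  destruct (nonlin_near_gaussian h h' t0 d HC Ht0 Hhpos Hlim Hd) as (T & HT & Hg).
  set (f := fun t => nonlin h (Rmax 0 t)) in *.
  set (df := fun t => (2 * t * h t + h' t) * exp (t ^ 2)) in *.
  assert (Cf : continuity f) by (apply (nonlin_extension_continuity h h'); exact HC).
  assert (Hf : forall t, 0 <= t -> 0 <= f t).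
  { intros t Ht. apply Rmult_le_pos; [apply Hh0, Rmax_l|left; apply exp_pos]. }
  set (K := Rabs (ln (f T)) + 2 * T ^ 2).
  assert (HK : 0 <= K).
  { unfold K. generalize (Rabs_pos (ln (f T))) (pow2_ge_0 T). lra. }
  assert (0 < / d) by (apply Rinv_0_lt_compat; lra).
  assert (0 < T / e) by (apply Rdiv_lt_0_compat; lra).
  assert (0 < 1024 / (e ^ 2 * d)).
  { apply Rdiv_lt_0_compat; [lra|]. apply Rmult_lt_0_compat; [apply pow_lt|]; lra. }
  assert (0 <= K / (d / 2)) by (apply Rdiv_le_0_compat; lra).
  (* A sum instead of a maximum: the summands are nonnegative, so [mu] exceeds each of them. The
     leading 1 gives [mu] <= [mu]^2, and each other summand secures one condition of the estimate
     for a single profile. *)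
  exists (1 + / d + T / e + 1024 / (e ^ 2 * d) + K / (d / 2)).
  intros lam mu u Hmu0 Hsol.
  destruct (solution_profile (nonlin h) f lam mu u) as (v & M & Hp & Hvu & HRInt);
    [intros t Ht; unfold f; rewrite Rmax_right by exact Ht; reflexivity|exact Cf|exact Hsol|].
  assert (Hlam : 0 < lam) by apply Hp.
  assert (Hsum : forall a b c k, 0 < a -> 0 < b -> 0 < c -> 0 <= k -> 1 + a + b + c + k < mu ->
    1 < mu /\ a < mu /\ b < mu /\ c < mu /\ k < mu) by (intros; repeat split; lra).
  destruct (Hsum (/ d) (T / e) (1024 / (e ^ 2 * d)) (K / (d / 2)))
    as (Hmu1 & Hmud & HmuT & Hmue & HmuK);
    try assumption.
  assert (Hmu2 : mu <= mu ^ 2) by nra.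
  destruct (single_bubble_estimate f df d e T lam mu v M Cf Hf He Hde HT) as
    [(r & Hr & Hvr & HMr) Hln]; try assumption.
  - apply Rlt_div_l in HmuT; lra.
  - apply Rmult_le_reg_l with (/ d); [lra|]. rewrite <- Rmult_assoc, Rinv_l by lra. lra.
  - apply exp_quadratic_decay; lra.
  - fold K. apply Rlt_div_l in HmuK; [|lra].
    assert (mu * (d / 2) <= mu ^ 2 * (d / 2)) by (apply Rmult_le_compat_r; lra). lra.
  - split.
    + exists r. split; [exact Hr|]. rewrite <- Hvu, Hvr, HRInt by lra.
      split; [field; lra|].
      replace (2 * mu * (M r / mu) - 4) with (2 * (M r - 2)) by (field; lra).
      rewrite Rabs_mult, (Rabs_right 2) by lra. lra.
    + unfold Rdiv at 2. rewrite Rmult_1_l, ln_Rinv by exact Hlam.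
      rewrite Rabs_div, Rabs_Ropp, (Rabs_right (mu ^ 2)) by lra.
      apply Rle_div_l; lra.
Qed.

(** * Extraction of the subsequence and passage to the limit *)

Lemma subsequence_of_eventually (P : nat -> nat -> Prop) :
  (forall k, exists N, forall n, (N <= n)%nat -> P k n) ->
  exists phi : nat -> nat,
    (forall k, (phi k < phi (S k))%nat) /\ (forall k, P k (phi k)).
Proof.
  intros HP. destruct (functional_choice _ HP) as [N HN].
  exists (fix phi k := match k with O => N O | S j => Nat.max (S (phi j)) (N (S j)) end).
  split.
  - intros k. apply Nat.le_max_l.
  - intros [|k]; apply HN; [apply le_n|apply Nat.le_max_r].
Qed.

Theorem theorem1p3 (h h' : R -> R) (t0 : R)
  (h_C1 : C1_on (fun t => 0 <= t) h h')
  (h_ge0 : forall t, 0 <= t -> 0 <= h t)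
  (t0_gt0 : 0 < t0)
  (h_gt0 : forall t, t0 <= t -> 0 < h t)
  (h_lim : is_lim (fun t => h' t / (t * h t)) p_infty 0)
  (lambda mu : nat -> R) (u : nat -> R -> R)
  (u_sol : forall n, solution (nonlin h) (lambda n) (mu n) (u n))
  (mu_lim : is_lim_seq mu p_infty) :
  (exists (phi : nat -> nat) (r : nat -> R),
     (forall n, (phi n < phi (S n))%nat) /\
     (forall n, 0 < r n < 1) /\
     is_lim_seq (fun n => u (phi n) (r n) / mu (phi n)) 0 /\
     is_lim_seq
       (fun n => 2 * mu (phi n) *
          RInt (fun s => lambda (phi n) * nonlin h (u (phi n) s) * s) 0 (r n))
       4) /\
  is_lim_seq (fun n => ln (1 / lambda n) / mu n ^ 2) 0.
Proof.
  apply is_lim_seq_spec in mu_lim.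
  assert (Hev : forall e, 0 < e <= 1 / 2 -> exists N, forall n, (N <= n)%nat ->
    (exists r, 0 < r < 1 /\ u n r / mu n = e /\
       Rabs (2 * mu n * RInt (fun s => lambda n * nonlin h (u n s) * s) 0 r - 4) <= 2 * e) /\
    Rabs (ln (1 / lambda n) / mu n ^ 2) <= 2 * e).
  { intros e He.
    destruct (bubble_estimate h h' t0 e h_C1 h_ge0 t0_gt0 h_gt0 h_lim He) as [mu0 Hmu0].
    destruct (mu_lim mu0) as [N HN]. exists N. intros n Hn.
    apply Hmu0; [apply HN; exact Hn|apply u_sol]. }
  (* The tolerances are 1/(k + 2), the shift by two keeping them at most 1/2 from k = 0 on. *)
  assert (Hk : forall k, 0 < / INR (S (S k)) <= 1 / 2).
  { intros k. rewrite !S_INR. generalize (pos_INR k); intros.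
    split; [apply Rinv_0_lt_compat; lra|].
    unfold Rdiv; rewrite Rmult_1_l. apply Rinv_le_contravar; lra. }
  assert (Hlim0 : is_lim_seq (fun k => / INR (S (S k))) 0).
  { apply (is_lim_seq_incr_1 (fun k => / INR (S k))), (is_lim_seq_incr_1 (fun k => / INR k)).
    apply (is_lim_seq_inv INR p_infty); [apply is_lim_seq_INR|discriminate]. }
  split.
  - destruct (subsequence_of_eventually _ (fun k => Hev _ (Hk k))) as (phi & Hphi & HP).
    destruct (functional_choice _ (fun k => proj1 (HP k))) as [r Hr].
    exists phi, r. split; [exact Hphi|]. split; [intros n; apply Hr|]. split.
    + apply is_lim_seq_ext with (2 := Hlim0). intros n. symmetry; apply Hr.
    + apply is_lim_seq_spec. intros eps.
      apply is_lim_seq_spec in Hlim0.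
      destruct (Hlim0 (mkposreal (eps / 2) ltac:(generalize (cond_pos eps); lra))) as [N HN].
      exists N. intros n Hn. specialize (HN n Hn). simpl pos in HN.
      rewrite Rminus_0_r, Rabs_right in HN by (generalize (Hk n); lra).
      eapply Rle_lt_trans; [apply Hr|lra].
  - apply is_lim_seq_spec. intros eps.
    (* The limit is along the full sequence, so the tolerance is fixed by [eps]: the bound 2 e is
       then at most [eps] / 2. *)
    assert (He : 0 < Rmin (eps / 4) (1 / 2) <= 1 / 2).
    { generalize (cond_pos eps); intros.
      split; [apply Rmin_pos; lra|apply Rmin_r]. }
    destruct (Hev _ He) as [N HN]. exists N. intros n Hn.
    destruct (HN n Hn) as [_ H]. rewrite Rminus_0_r.
    eapply Rle_lt_trans; [exact H|].
    generalize (Rmin_l (eps / 4) (1 / 2)) (cond_pos eps). lra.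
Qed.
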